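(* Let $\Omega$ be a finite set of arbitrary cardinality, $m\in\Delta(\Omega)$, $\lambda\in[0,1)$, and consider the irreducible Markov chain on $\Omega$ with transitions $\pi(\omega\mid\omega)=(1-\lambda)m(\omega)+\lambda$ and $\pi(\omega'\mid\omega)=(1-\lambda)m(\omega')$ for $\omega'\ne\omega$ (so $m$ is invariant and $\phi(p)=m+\lambda(p-m)$). Let $r:\Omega\to\mathbb{R}$ and $\delta\in[0,1)$. If the initial belief is $p_1=m$, then the greedy strategy $\sigma_*$ is optimal at $p_1$.
   Context: Identify each $\omega\in\Omega$ with a unit vector of $\mathbb{R}^\Omega$ and $\Delta(\Omega)$ with the unit simplex. For $p\in\Delta(\Omega)$ let $\langle p,r\rangle=\sum_\omega p(\omega)r(\omega)$; $I=\{p:\langle p,r\rangle\ge0\}$, $J=\Delta(\Omega)\setminus I$. $\phi(q)=qM$ with $M$ the transition matrix. $\mathcal{S}(p)$ is the set of Borel probability measures on $\Delta(\Omega)$ with mean $p$, $\mu_p$ the Dirac mass at $p$. Decision problem from $p_1$: at each stage $n$, at belief $p_n$, the advisor chooses $\mu\in\mathcal{S}(p_n)$ (possibly depending on the past), a posterior $q_n\sim\mu$ is drawn, the stage payoff is $\mathbf{1}_{\{q_n\in I\}}$, and $p_{n+1}=\phi(q_n)$. A strategy's payoff is $\mathbb{E}[(1-\delta)\sum_{n\ge1}\delta^{n-1}\mathbf{1}_{\{q_n\in I\}}]$; $V_\delta(p_1)$ is the maximal payoff; a strategy is optimal at $p_1$ if it achieves $V_\delta(p_1)$. The greedy strategy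 $\sigma_*$: at $p\in I$ choose $\mu_p$; at $p\in J$ choose a two-point splitting $p=a_Iq_I+a_Jq_J$ (posterior $q_I$ w.p. $a_I$, $q_J$ w.p. $a_J$) maximizing $a_I$ subject to $q_I\in I$, $q_J\in\Delta(\Omega)$, $a_I+a_J=1$, $a_I,a_J\ge0$. *)

(* Defs.v *)
From HB Require Import structures.
From mathcomp Require Import all_boot all_order all_algebra.
From mathcomp Require Import all_classical all_reals all_analysis.
Set Implicit Arguments. Unset Strict Implicit. Unset Printing Implicit Defensive.
Import Order.TTheory GRing.Theory Num.Theory.
Local Open Scope classical_set_scope.
Local Open Scope ring_scope.

Definition vec (R : realType) (Omega : finType) := Omega -> R.
HB.instance Definition _ (R : realType) (Omega : finType) := Choice.on (vec R Omega).
HB.instance Definition _ (R : realType) (Omega : finType) :=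
  isPointed.Build (vec R Omega) (fun _ => 0).

(* The Borel sigma-algebra of R^Omega (Omega finite) = the product sigma-algebra,
   generated by the coordinate maps. *)
Definition coord_sets (R : realType) (Omega : finType) : set (set (vec R Omega)) :=
  [set A | exists (w : Omega) (B : set R), measurable B /\ A = (fun q => q w) @^-1` B].

Notation belief R Omega := (g_sigma_algebraType (@coord_sets R Omega)).

Section Defs.
Variables (R : realType) (Omega : finType).

Definition simplex : set (vec R Omega) :=
  [set p | (forall w, 0 <= p w) /\ \sum_(w : Omega) p w = 1].

Definition inner (p r : vec R Omega) : R := \sum_(w : Omega) p w * r w.

Definition Iset (r : vec R Omega) : set (vec R Omega) :=
  [set p | simplex p /\ 0 <= inner p r].

Definition trans (m : vec R Omega) (lam : R) : Omega -> Omega -> R :=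
  fun w w' => (1 - lam) * m w' + (if w' == w then lam else 0).

Definition phi (M : Omega -> Omega -> R) (q : vec R Omega) : vec R Omega :=
  fun w' => \sum_(w : Omega) q w * M w w'.

Fixpoint Mpow (M : Omega -> Omega -> R) (n : nat) : Omega -> Omega -> R :=
  match n with
  | 0 => fun w w' => (w == w')%:R
  | n.+1 => fun w w'' => \sum_(w' : Omega) Mpow M n w w' * M w' w''
  end.

Definition irreducible (M : Omega -> Omega -> R) : Prop :=
  forall w w' : Omega, exists n : nat, 0 < Mpow M n w w'.

(* mu in S(p): a Borel probability measure on Delta(Omega) with mean p
   (represented as a probability measure on R^Omega carried by Delta(Omega)). *)
Definition in_S (mu : probability (belief R Omega) R) (p : vec R Omega) : Prop :=
  mu simplex = 1%E /\
  forall w : Omega, (\int[mu]_q (q w)%:E)%E = (p w)%:E.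

(* A (behavioural) strategy: given the past posteriors q_1, ..., q_{n-1},
   choose a probability measure for q_n. *)
Definition strategy := seq (vec R Omega) -> probability (belief R Omega) R.

Definition cur_belief (p1 : vec R Omega) (M : Omega -> Omega -> R)
  (h : seq (vec R Omega)) : vec R Omega :=
  match h with
  | [::] => p1
  | q :: t => phi M (last q t)
  end.

(* All entries of a history lie in Delta(Omega) (the only histories that can occur). *)
Definition simplex_hist (h : seq (vec R Omega)) : Prop :=
  forall i, (i < size h)%N -> simplex (nth (fun _ => 0) h i).

Definition admissible (p1 : vec R Omega) (M : Omega -> Omega -> R) (s : strategy) : Prop :=
  forall h, simplex_hist h -> in_S (s h) (cur_belief p1 M h).

Fixpoint partial_payoff (r : vec R Omega) (delta : R) (s : strategy) (N : nat)
  (h : seq (vec R Omega)) : \bar R :=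
  match N with
  | 0 => 0%E
  | N'.+1 => (\int[s h]_q (((1 - delta) * \1_(Iset r) q)%:E
                + delta%:E * partial_payoff r delta s N' (rcons h q)))%E
  end.

(* E[(1-delta) sum_{n>=1} delta^{n-1} 1_{q_n in I}] = limit (= sup) of the
   nondecreasing partial expected sums. *)
Definition payoff (r : vec R Omega) (delta : R) (s : strategy) : \bar R :=
  ereal_sup (range (fun N => partial_payoff r delta s N [::])).

Definition value (r : vec R Omega) (delta : R) (p1 : vec R Omega)
  (M : Omega -> Omega -> R) : \bar R :=
  ereal_sup [set payoff r delta s | s in admissible p1 M].

Definition feasible_split (r p : vec R Omega) (a : R) (qI qJ : vec R Omega) : Prop :=
  0 <= a <= 1 /\ Iset r qI /\ simplex qJ /\
  forall w, p w = a * qI w + (1 - a) * qJ w.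

Definition greedy_split (r p : vec R Omega) (a : R) (qI qJ : vec R Omega) : Prop :=
  feasible_split r p a qI qJ /\
  forall a' qI' qJ', feasible_split r p a' qI' qJ' -> a' <= a.

(* s is the greedy strategy sigma_* (with the maximizing splitting at each
   p in J given by the selection g): at p in I play the Dirac mass at p; at p in J
   play a_I delta_{q_I} + a_J delta_{q_J}. *)
Definition is_greedy_strategy (r p1 : vec R Omega) (M : Omega -> Omega -> R)
  (g : vec R Omega -> R * vec R Omega * vec R Omega) (s : strategy) : Prop :=
  forall h, simplex_hist h -> let p := cur_belief p1 M h in
  forall A : set (belief R Omega), measurable A ->
    (Iset r p -> s h A = \d_(p : belief R Omega) A) /\
    (~ Iset r p ->
       s h A = ((g p).1.1%:E * \d_((g p).1.2 : belief R Omega) A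
                + (1 - (g p).1.1)%:E * \d_((g p).2 : belief R Omega) A)%E).

End Defs.

(* Main.v *)
Require Import Defs.
From HB Require Import structures.
From mathcomp Require Import all_boot all_order all_algebra.
From mathcomp Require Import all_classical all_reals all_analysis.
From mathcomp Require Import measurable_realfun ring lra.
Set Implicit Arguments. Unset Strict Implicit. Unset Printing Implicit Defensive.
Import Order.TTheory GRing.Theory Num.Theory.
Local Open Scope classical_set_scope.
Local Open Scope ring_scope.

(* At the invariant belief m every admissible strategy has E[q_n] = m at each
   stage n, so the stage payoff P(q_n in I) is at most the concave envelope of
   1_I at m. By duality for the fractional knapsack problem, this envelope is
   attained at m by a linear function q |-> <q, c> that dominates 1_I on the
   whole simplex. If <., c> is tight at p, then after a greedy split of p it is
   tight at both posteriors, where it takes the values 1 and 0; since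
   phi(q) = (1 - lam) m + lam q is a convex combination of m and q, it stays
   tight at the next belief. So the greedy strategy attains the bound at every
   stage. *)

(** * Comparison of integrals without measurability of the smaller function *)

(* The integral of a nonnegative function is a supremum over simple functions
   below it, so monotonicity needs no measurability. Strategies are not assumed
   measurable in the history, hence neither are the integrands of
   [partial_payoff]. *)
Lemma ge0_le_integralT (d : measure_display) (T : measurableType d)
    (R : realType) (mu : {measure set T -> \bar R}) (f g : T -> \bar R) :
  (forall x, 0 <= f x)%E -> (forall x, f x <= g x)%E ->
  (\int[mu]_x f x <= \int[mu]_x g x)%E.
Proof.
move=> f0 fg.
have g0 x : (0 <= g x)%E := le_trans (f0 x) (fg x).
rewrite !ge0_integralTE//; apply: ereal_sup_le => _ [h hf <-].
by exists h => // x; exact: le_trans (hf x) (fg x).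
Qed.

(** Adding [+oo] to [g] off [S] leaves its integral unchanged, as the complement of [S] is null, and
    makes the comparison hold everywhere. Only [g] is modified, since [f] need not be measurable. *)
Lemma ge0_le_integral_carrier (d : measure_display) (T : measurableType d)
    (R : realType) (mu : {measure set T -> \bar R}) (S : set T)
    (f g : T -> \bar R) :
  measurable S -> mu (~` S) = 0%E -> measurable_fun setT g ->
  (forall x, 0 <= f x)%E -> (forall x, 0 <= g x)%E ->
  (forall x, S x -> f x <= g x)%E ->
  (\int[mu]_x f x <= \int[mu]_x g x)%E.
Proof.
move=> mS muS mg f0 g0 fg.
have mI : measurable_fun setT (fun x => (\1_(~` S) x : R)%:E).
  by apply/measurable_EFinP/measurable_indic/measurableC.
have -> : (\int[mu]_x g x = \int[mu]_x (g x + +oo * (\1_(~` S) x)%:E))%E.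
  rewrite ge0_integralD//; last by exact: emeasurable_funM.
  rewrite ge0_integralZl//.
  by rewrite integral_indic ?setIT ?muS ?mule0 ?adde0//; exact: measurableC.
apply: ge0_le_integralT => // x.
have [Sx|Sx] := pselect (S x).
  by rewrite indicE memNset ?mule0 ?adde0 ?fg//; exact.
by rewrite indicE mem_set// mule1 addey ?leey// gt_eqF// (lt_le_trans _ (g0 x)).
Qed.

(** * Measurability on the belief space and integrals against splittings *)

Section belief.
Variables (R : realType) (Omega : finType).
Implicit Types (p q r c m x y : vec R Omega) (mu : probability (belief R Omega) R).

Lemma measurable_coord (w : Omega) :
  measurable_fun setT (fun q : belief R Omega => (q w : R)).
Proof.
move=> _ B mB; rewrite setTI; apply: sub_sigma_algebra.
by exists w, B; split.
Qed.

Lemma measurable_belief_set1 x : measurable ([set x] : set (belief R Omega)).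
Proof.
have -> : [set x] = \bigcap_(w in [set: Omega])
    ((fun q : belief R Omega => (q w : R)) @^-1` [set x w]).
  apply/seteqP; split => [_ -> //|q qx].
  by apply/funext => w; exact: qx.
apply: fin_bigcap_measurable => // w _; rewrite -[X in measurable X]setTI.
exact: measurable_coord.
Qed.

Lemma measurable_simplex : measurable (@simplex R Omega : set (belief R Omega)).
Proof.
have -> : @simplex R Omega = (\bigcap_(w in [set: Omega])
    ((fun q : belief R Omega => (q w : R)) @^-1` `[0, +oo[)) `&`
    ((fun q : belief R Omega => \sum_w (q w : R)) @^-1` [set 1]).
  apply/seteqP; split => q [q0 q1]; split => // w.
    by move=> _; rewrite /= in_itv/= andbT.
  by have := q0 w I; rewrite /= in_itv/= andbT.
apply: measurableI.
  apply: fin_bigcap_measurable => // w _; rewrite -[X in measurable X]setTI.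
  exact: measurable_coord.
rewrite -[X in measurable X]setTI.
have : measurable_fun setT (fun q : belief R Omega => \sum_w (q w : R)).
  by apply: measurable_sum => w; exact: measurable_coord.
exact.
Qed.

Lemma measurable_coord_norm (w : Omega) :
  measurable_fun setT (fun q : belief R Omega => `|q w : R|%:E).
Proof.
apply/measurable_EFinP; apply: measurableT_comp => //; exact: measurable_coord.
Qed.

Lemma simplex_setC mu : mu (@simplex R Omega) = 1%E -> mu (~` @simplex R Omega) = 0%E.
Proof.
move=> mu1; rewrite probability_setC ?mu1 ?subee//; exact: measurable_simplex.
Qed.

(** Coordinates can be negative off the simplex; absolute values make the integrand nonnegative
    everywhere, as the lemmas on nonnegative integrals require. *)
Lemma integral_coord_norm mu (w : Omega) : mu (@simplex R Omega) = 1%E ->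
  (\int[mu]_q (q w)%:E = \int[mu]_q `|q w|%:E)%E.
Proof.
move=> mu1; apply: ae_eq_integral => //.
- by apply/measurable_EFinP; exact: measurable_coord.
- exact: measurable_coord_norm.
- exists (~` @simplex R Omega); split.
  + by apply: measurableC; exact: measurable_simplex.
  + exact: simplex_setC.
  + move=> q /= nq sq; apply: nq => _; rewrite ger0_norm//; exact: sq.1.
Qed.

(** A linear function integrates to its value at the mean [p], so a linear upper bound on the payoff
    after the draw passes to the belief before it. *)
Lemma le_integral_in_S mu p c (f : vec R Omega -> \bar R) :
  in_S mu p -> (forall w, 0 <= c w) -> (forall q, 0 <= f q)%E ->
  (forall q, simplex q -> f q <= (inner q c)%:E)%E ->
  (\int[mu]_q f q <= (inner p c)%:E)%E.
Proof.
move=> [mu1 mup] c0 f0 fc.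
have m0 w : measurable_fun setT (fun q : belief R Omega => (c w)%:E * `|q w : R|%:E)%E.
  by apply: emeasurable_funM => //; exact: measurable_coord_norm.
have g0 w (q : belief R Omega) : (0 <= (c w)%:E * `|q w : R|%:E)%E.
  by rewrite mule_ge0 ?lee_fin.
have -> : ((inner p c)%:E = \int[mu]_q \sum_w ((c w)%:E * `|q w|%:E))%E.
  rewrite ge0_integral_sum//.
  rewrite /inner -sumEFin; apply: eq_bigr => w _.
  rewrite ge0_integralZl//; [|exact: measurable_coord_norm|by rewrite lee_fin].
  by rewrite -integral_coord_norm// mup -EFinM mulrC.
apply: (@ge0_le_integral_carrier _ (belief R Omega) R mu (@simplex R Omega)) => //.
- exact: measurable_simplex.
- exact: simplex_setC.
- exact: emeasurable_sum.
- by move=> q; exact: sume_ge0.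
- move=> q sq; apply: le_trans (fc _ sq) _.
  rewrite /inner -sumEFin; apply: lee_sum => w _.
  by rewrite -EFinM [_ * c w]mulrC ger0_norm//; exact: sq.1.
Qed.

Definition two_point mu (a : R) x y := forall A : set (belief R Omega),
  measurable A -> mu A = (a%:E * \d_(x : belief R Omega) A
                          + (1 - a)%:E * \d_(y : belief R Omega) A)%E.

Lemma ge0_integral_two_point mu (a : R) x y (f : belief R Omega -> \bar R) :
  0 <= a <= 1 -> two_point mu a x y ->
  measurable_fun setT f -> (forall q, 0 <= f q)%E ->
  (\int[mu]_q f q = a%:E * f x + (1 - a)%:E * f y)%E.
Proof.
move=> /andP[a0 a1] muE mf f0.
have b0 : 0 <= 1 - a by rewrite subr_ge0.
pose nu := measure_add (mscale (NngNum a0) \d_(x : belief R Omega))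
                       (mscale (NngNum b0) \d_(y : belief R Omega)).
rewrite (@eq_measure_integral _ _ _ _ nu); last first.
  by move=> A mA _; apply: etrans (muE _ mA) _; exact/esym/measure_addE.
rewrite ge0_integral_measure_add//.
by rewrite !ge0_integral_mscale// !integral_dirac// !diracT !mul1e.
Qed.

(** For arbitrary nonnegative [f], the function equal to [f] at [x] and [y] and zero elsewhere is a
    measurable minorant. It is built as a maximum rather than a sum, so that [x = y] is not counted
    twice. *)
Lemma ge_integral_two_point mu (a : R) x y (f : vec R Omega -> \bar R) :
  0 <= a <= 1 -> two_point mu a x y -> (forall q, 0 <= f q)%E ->
  (a%:E * f x + (1 - a)%:E * f y <= \int[mu]_q f q)%E.
Proof.
move=> a01 muE f0.
have /andP[a0 a1] := a01.
pose h z := fun q : belief R Omega => (f z * (\1_[set (z : belief R Omega)] q)%:E)%E.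
have mh z : measurable_fun setT (h z).
  apply: emeasurable_funM => //; apply/measurable_EFinP/measurable_indic.
  exact: measurable_belief_set1.
have hf z q : (h z q <= f q)%E.
  rewrite /h indicE; have [->|zq] := eqVneq q z.
    by rewrite mem_set// mule1.
  by rewrite memNset ?mule0//= => /eqP; rewrite (negbTE zq).
have hz z : h z z = f z by rewrite /h indicE mem_set// mule1.
pose k q := maxe (h x q) (h y q).
have k0 q : (0 <= k q)%E by rewrite le_max mule_ge0// lee_fin.
apply: (@le_trans _ _ (\int[mu]_q k q)%E); last first.
  by apply: ge0_le_integralT => // q; rewrite ge_max !hf.
rewrite (@ge0_integral_two_point _ a x y)//; last exact: measurable_maxe.
by apply: leeD; apply: lee_wpmul2l; rewrite ?lee_fin ?subr_ge0// le_max hz lexx ?orbT.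
Qed.

Lemma in_S_two_point mu (a : R) x y p : 0 <= a <= 1 -> two_point mu a x y ->
  simplex x -> simplex y -> (forall w, p w = a * x w + (1 - a) * y w) ->
  in_S mu p.
Proof.
move=> a01 muE sx sy pE.
have mu1 : mu (@simplex R Omega) = 1%E.
  rewrite muE; last exact: measurable_simplex.
  by rewrite !diracE !mem_set// !mule1 -EFinD addrC subrK.
split => // w; rewrite integral_coord_norm// (ge0_integral_two_point a01 muE)//.
  by rewrite !ger0_norm ?(sx.1,sy.1)// -!EFinM -EFinD -pE.
exact: measurable_coord_norm.
Qed.

(** * Linear functions of beliefs and the transition map *)

Lemma inner_lin (a b : R) x y c :
  inner (fun w => a * x w + b * y w) c = a * inner x c + b * inner y c.
Proof.
rewrite /inner !mulr_sumr -big_split/=; apply: eq_bigr => w _; ring.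
Qed.

Lemma inner_linr (a b : R) q x y :
  inner q (fun w => a * x w + b * y w) = a * inner q x + b * inner q y.
Proof.
rewrite /inner !mulr_sumr -big_split/=; apply: eq_bigr => w _; ring.
Qed.

Lemma inner_ge0 q c : (forall w, 0 <= q w) -> (forall w, 0 <= c w) -> 0 <= inner q c.
Proof. by move=> q0 c0; apply: sumr_ge0 => w _; exact: mulr_ge0. Qed.

Lemma inner1 q : inner q (fun=> 1) = \sum_w q w.
Proof. by apply: eq_bigr => w _; rewrite mulr1. Qed.

Lemma inner_phi (M : Omega -> Omega -> R) q c :
  inner (phi M q) c = inner q (fun w => \sum_w' M w w' * c w').
Proof.
rewrite /inner /phi; under eq_bigr do rewrite mulr_suml.
rewrite exchange_big/=; apply: eq_bigr => w _; rewrite mulr_sumr.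
by apply: eq_bigr => w' _; rewrite mulrA.
Qed.

Lemma phi_trans m (lam : R) q : simplex q ->
  phi (trans m lam) q = (fun w => (1 - lam) * m w + lam * q w).
Proof.
move=> [_ q1]; apply/funext => w; rewrite /phi /trans.
under eq_bigr do rewrite mulrDr.
rewrite big_split/= -mulr_suml q1 mul1r; congr (_ + _).
rewrite (bigD1 w)//= eqxx big1 ?addr0 1?mulrC// => w' /negbTE.
by rewrite eq_sym => ->; rewrite mulr0.
Qed.

Lemma simplex_conv (t : R) p q : 0 <= t <= 1 -> simplex p -> simplex q ->
  simplex (fun w => (1 - t) * p w + t * q w).
Proof.
move=> /andP[t0 t1] [p0 p1] [q0 q1]; split.
  by move=> w; rewrite addr_ge0// mulr_ge0// subr_ge0.
by rewrite big_split/= -!mulr_sumr p1 q1; ring.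
Qed.

Lemma simplex_phi m (lam : R) q : 0 <= lam <= 1 -> simplex m -> simplex q ->
  simplex (phi (trans m lam) q).
Proof. by move=> l01 sm sq; rewrite phi_trans//; exact: simplex_conv. Qed.

Lemma trans_ge0 m (lam : R) (w w' : Omega) : 0 <= lam <= 1 -> simplex m ->
  0 <= trans m lam w w'.
Proof.
move=> /andP[l0 l1] [m0 _]; rewrite addr_ge0 ?mulr_ge0 ?subr_ge0//.
by case: ifP.
Qed.

(** * Dominating linear functions, tightness and knapsack duality *)

(* A linear function dominating the indicator of I on the simplex, hence also its
   concave envelope. *)
Definition dominates r c :=
  (forall w, 0 <= c w) /\ (forall q, Iset r q -> 1 <= inner q c).

(* [x] is the unnormalised I-part [a_I q_I] of a splitting of [p]; so [c], if it
   dominates, is tight at [p]. *)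
Definition tight_at r c p := simplex p /\ exists x,
  [/\ forall w, 0 <= x w <= p w, 0 <= inner x r & inner p c <= \sum_w x w].

Lemma tight_at_conv r c (t : R) p q : 0 <= t <= 1 ->
  tight_at r c p -> tight_at r c q ->
  tight_at r c (fun w => (1 - t) * p w + t * q w).
Proof.
move=> t01 [sp [x [xp xr xc]]] [sq [y [yq yr yc]]].
split; first exact: simplex_conv.
have /andP[t0 t1] := t01.
have s0 : 0 <= 1 - t by rewrite subr_ge0.
exists (fun w => (1 - t) * x w + t * y w); split.
- move=> w; have /andP[x0 xpw] := xp w; have /andP[y0 yqw] := yq w.
  by rewrite addr_ge0 ?mulr_ge0//= lerD// ler_wpM2l.
- by rewrite inner_lin addr_ge0// mulr_ge0.
- by rewrite inner_lin big_split/= -!mulr_sumr lerD// ler_wpM2l.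
Qed.

Lemma tight_at_Iset r c q : Iset r q -> inner q c <= 1 -> tight_at r c q.
Proof.
move=> [sq qr] qc; split => //; exists q; split => //.
  by move=> w; rewrite lexx andbT; exact: sq.1.
by rewrite sq.2.
Qed.

Lemma tight_at_zero r c q : simplex q -> inner q c <= 0 -> tight_at r c q.
Proof.
move=> sq qc; split => //; exists (fun=> 0); split.
- by move=> w; rewrite lexx/=; exact: sq.1.
- by rewrite /inner big1// => w _; rewrite mul0r.
- by rewrite big1.
Qed.

(** Normalising [x] and [p - x] gives the two posteriors. A part of zero weight still needs a
    posterior: [q0] serves in [I], and [p] on the other side. *)
Lemma feasible_split_of_le r p q0 x : simplex p -> Iset r q0 ->
  (forall w, 0 <= x w <= p w) -> 0 <= inner x r ->
  exists qI qJ, feasible_split r p (\sum_w x w) qI qJ.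
Proof.
move=> [p0 p1] Iq0 xp xr; set a := \sum_w x w.
have x0 w : 0 <= x w by have /andP[] := xp w.
have xlep w : x w <= p w by have /andP[] := xp w.
have a0 : 0 <= a by exact: sumr_ge0.
have a1 : a <= 1 by rewrite -p1; exact: ler_sum.
have [qI [IqI qIE]] : exists qI, Iset r qI /\ forall w, x w = a * qI w.
  have [a_eq0|a_neq0] := eqVneq a 0.
    exists q0; split => // w; rewrite a_eq0 mul0r.
    have /eqP := a_eq0; rewrite psumr_eq0// => /allP/(_ w (mem_index_enum _)).
    by move=> /eqP.
  exists (fun w => a^-1 * x w); split; last by move=> w; rewrite mulVKf.
  split; first split.
  - by move=> w; rewrite mulr_ge0// invr_ge0.
  - by rewrite -mulr_sumr mulVf.
  - have -> : inner (fun w => a^-1 * x w) r = a^-1 * inner x r.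
      by rewrite /inner mulr_sumr; apply: eq_bigr => w _; rewrite mulrA.
    by rewrite mulr_ge0// invr_ge0.
have pxE : \sum_w (p w - x w) = 1 - a by rewrite sumrB p1.
have px0 w : 0 <= p w - x w by rewrite subr_ge0.
have [qJ [sqJ qJE]] : exists qJ, simplex qJ /\ forall w, p w - x w = (1 - a) * qJ w.
  have [b_eq0|b_neq0] := eqVneq (1 - a) 0.
    exists p; split => // w; rewrite b_eq0 mul0r.
    move: pxE; rewrite b_eq0 => /eqP.
    by rewrite psumr_eq0// => /allP/(_ w (mem_index_enum _))/eqP.
  exists (fun w => (1 - a)^-1 * (p w - x w)); split; last by move=> w; rewrite mulVKf.
  split; first by move=> w; rewrite mulr_ge0// invr_ge0 subr_ge0.
  by rewrite -mulr_sumr pxE mulVf.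
exists qI, qJ; split; first by rewrite a0.
by split => //; split => // w; rewrite -qIE -qJE addrC subrK.
Qed.

(* Fractional knapsack: fill the I-part with the states in decreasing order of
   [r] until the inner product with [r] drops to zero, at the critical level [t]. *)
Lemma knapsack_level r m : simplex m -> inner m r < 0 ->
  exists t, 0 <= \sum_(w | t < r w) m w * r w /\
            \sum_(w | t < r w) m w * r w + t * \sum_(w | r w == t) m w < 0.
Proof.
move=> [m0 m1] mr.
(* [P w] says that taking all states at least as good as [w] overshoots. It holds at a minimiser of
   [r], where all of [m] is taken; the critical level is the largest value of [r] on [P]. *)
pose P w := \sum_(w' | r w <= r w') m w' * r w' < 0.
have [w0 _|no] := pickP (@predT Omega); last first.
  by move/eqP: m1; rewrite big_pred0// eq_sym oner_eq0.
have Pmin : P [arg min_(w < w0) r w]%O.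
  rewrite /P; case: arg_minP => // i _ imin.
  by rewrite (eq_bigl predT)// => w; rewrite imin.
case: (arg_maxP r Pmin) => ws Pws wsmax; exists (r ws); split; last first.
  move: Pws; rewrite /P (bigID (fun w => r ws < r w))/= mulr_sumr.
  congr (_ + _ < _).
    by apply: eq_bigl => w; rewrite andb_idl// => /ltW.
  apply: eq_big => [w|w /andP[le1 le2]].
    by rewrite -leNgt -eq_le eq_sym.
  have -> : r w = r ws by apply/eqP; rewrite eq_le le1 leNgt le2.
  by rewrite mulrC.
(* If some state lies above the level, the states above it are those at least as good as the worst
   of them, [w2]; by maximality of [ws], [P w2] fails. *)
have [/existsP[w1 w1P]|/existsPn no] := boolP [exists w, r ws < r w]; last first.
  by rewrite big_pred0// => w; apply/negbTE/no.
case: (@arg_minP _ _ _ w1 (fun w => r ws < r w) r w1P) => w2 w2P w2min.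
rewrite (eq_bigl (fun w => r w2 <= r w)).
  rewrite leNgt; apply/negP => /wsmax; apply/negP; by rewrite -ltNge.
by move=> w; apply/idP/idP => [/w2min//|]; exact: lt_le_trans.
Qed.

(** If [m] is in [I], the constant 1 works. Otherwise [c] is the positive part of [1 - r / t], with
    [- t^-1 > 0] the multiplier of the constraint [0 <= inner x r]. Tightness is complementary
    slackness: [c] vanishes where [r w <= t]. *)
Lemma dominates_tight_at r m : simplex m -> exists c, dominates r c /\ tight_at r c m.
Proof.
move=> sm; have [mr|mr] := leP 0 (inner m r).
  exists (fun=> 1); split; last by apply: tight_at_Iset => //; rewrite inner1 sm.2.
  by split => // q [[_ q1] _]; rewrite inner1 q1.
have [m0 m1] := sm.
have [t []] := knapsack_level sm mr.
set B := \sum_(w | t < r w) _; set E := \sum_(w | _ == t) m w => B0 BE.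
have E0 : 0 <= E by exact: sumr_ge0.
have tE0 : t * E < 0 by lra.
have t0 : t < 0 by rewrite ltNge; apply/negP => t0; have := mulr_ge0 t0 E0; lra.
have tn0 : t != 0 by rewrite lt_eqF.
have En0 : E != 0 by apply/eqP => E00; move: tE0; rewrite E00 mulr0 ltxx.
have k0 : 0 < - t^-1 by rewrite oppr_gt0 invr_lt0.
have c0 w : 0 <= Num.max 0 (1 - t^-1 * r w) by rewrite le_max lexx.
exists (fun w => Num.max 0 (1 - t^-1 * r w)); split.
  split => // q [[q0 q1] qr].
  apply: (@le_trans _ _ (inner q (fun w => 1 * 1 + (- t^-1) * r w))).
    by rewrite (inner_linr 1 (- t^-1) q (fun=> 1) r) inner1 q1 mulr1 lerDl mulr_ge0// ltW.
  apply: ler_sum => w _; rewrite ler_wpM2l// mulr1 mulNr.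
  by rewrite le_max lexx orbT.
(* The fraction of the critical states that brings the inner product of the [I]-part with [r] to
   exactly zero; [BE] gives [th <= 1]. *)
split => //; pose th := B / - (t * E).
have th0 : 0 <= th by rewrite divr_ge0//; lra.
have th1 : th <= 1 by rewrite ler_pdivrMr; lra.
have thE : th * E = - (t^-1 * B) by rewrite /th; field; rewrite tn0 En0.
exists (fun w => if t < r w then m w else if r w == t then th * m w else 0); split.
- move=> w; case: ifP => _; first by rewrite m0 lexx.
  by case: ifP => _; rewrite ?lexx ?m0// mulr_ge0//= ler_piMl.
- suff -> : inner (fun w => if t < r w then m w else if r w == t then th * m w else 0) r
      = B + t * (th * E) by rewrite thE mulrN mulVKf// subrr.
  rewrite /inner (bigID (fun w => t < r w))/=; congr (_ + _).
    by apply: eq_bigr => w ->.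
  rewrite !mulr_sumr [RHS]big_mkcond/= big_mkcond/=; apply: eq_bigr => w _.
  case: ltP => //= rt; first by rewrite gt_eqF.
  by case: eqP => [->|_]; [ring|rewrite mul0r].
- rewrite /inner (bigID (fun w => t < r w))/= [leRHS](bigID (fun w => t < r w))/=.
  rewrite [X in X + _ <= _](_ : _ = \sum_(w | t < r w) m w - t^-1 * B).
    rewrite [X in _ + X <= _]big1 ?addr0.
      rewrite (_ : \sum_(w | ~~ _) _ = th * E).
        by rewrite thE lerD2r; apply: ler_sum => w ->.
      rewrite mulr_sumr [RHS]big_mkcond/= big_mkcond/=; apply: eq_bigr => w _.
      by case: ltP => //= rt; rewrite gt_eqF.
    move=> w; rewrite -leNgt => rt; rewrite max_l ?mulr0//.
    by rewrite subr_le0 ler_ndivlMl// mulr1.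
  rewrite mulr_sumr -sumrB; apply: eq_bigr => w tr.
  rewrite max_r; first by ring.
  by rewrite subr_ge0 ler_ndivrMl// mulr1 ltW.
Qed.

(** This is $(1-\delta)\sum_{k<N}\delta^k M^k c$: paired with a belief, it gives the [N]-stage
    payoff when every stage earns the value of [c] at the current mean. Applying [M] to [c] keeps
    the bound linear in the belief. *)
Fixpoint horizon (M : Omega -> Omega -> R) c (delta : R) (N : nat) : vec R Omega :=
  match N with
  | 0 => fun=> 0
  | N'.+1 => fun w =>
      (1 - delta) * c w + delta * \sum_w' M w w' * horizon M c delta N' w'
  end.

Lemma horizon_ge0 (M : Omega -> Omega -> R) c (delta : R) (N : nat) (w : Omega) :
  (forall w w', 0 <= M w w') -> (forall w, 0 <= c w) -> 0 <= delta <= 1 ->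
  0 <= horizon M c delta N w.
Proof.
move=> M0 c0 /andP[d0 d1]; elim: N w => //= N IH w.
rewrite addr_ge0// mulr_ge0 ?subr_ge0//.
by apply: sumr_ge0 => w' _; rewrite mulr_ge0.
Qed.

Lemma inner_horizonS (M : Omega -> Omega -> R) c (delta : R) (N : nat) q :
  inner q (horizon M c delta N.+1) =
  (1 - delta) * inner q c + delta * inner (phi M q) (horizon M c delta N).
Proof. by rewrite inner_phi -inner_linr. Qed.

(** * Upper bound on the payoff of an arbitrary admissible strategy *)

Lemma partial_payoff_ge0 r (delta : R) (s : strategy R Omega) (N : nat) h :
  0 <= delta <= 1 -> (0 <= partial_payoff r delta s N h)%E.
Proof.
move=> /andP[d0 d1]; elim: N h => //= N IH h.
apply: integral_ge0 => q _; rewrite adde_ge0 ?mule_ge0 ?lee_fin//.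
by rewrite mulr_ge0// subr_ge0.
Qed.

Lemma stage_payoff_ge0 r (delta : R) (s : strategy R Omega) (N : nat) h q :
  0 <= delta <= 1 ->
  (0 <= ((1 - delta) * \1_(Iset r) q)%:E
        + delta%:E * partial_payoff r delta s N (rcons h q))%E.
Proof.
move=> d01; have /andP[d0 d1] := d01.
rewrite adde_ge0 ?mule_ge0 ?lee_fin ?partial_payoff_ge0//.
by rewrite mulr_ge0// subr_ge0.
Qed.

Lemma simplex_hist_rcons (h : seq (vec R Omega)) q :
  simplex_hist h -> simplex q -> simplex_hist (rcons h q).
Proof.
move=> sh sq i; rewrite size_rcons ltnS nth_rcons leq_eqVlt => /predU1P[->|ih].
  by rewrite ltnn eqxx.
by rewrite ih; exact: sh.
Qed.

Lemma cur_belief_rcons p (M : Omega -> Omega -> R) (h : seq (vec R Omega)) q :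
  cur_belief p M (rcons h q) = phi M q.
Proof. by case: h => //= q' h; rewrite last_rcons. Qed.

(** Induction on the number of remaining stages: after the draw [q], domination bounds the stage
    payoff and the induction hypothesis the continuation, both by linear functions of [q]. *)
Lemma partial_payoff_le r c (delta : R) p (M : Omega -> Omega -> R)
    (s : strategy R Omega) (N : nat) h :
  (forall w w', 0 <= M w w') -> dominates r c -> 0 <= delta <= 1 ->
  admissible p M s -> simplex_hist h ->
  (partial_payoff r delta s N h <= (inner (cur_belief p M h) (horizon M c delta N))%:E)%E.
Proof.
move=> M0 [c0 c1] d01 adm; have /andP[d0 d1] := d01.
elim: N h => [|N IH] h sh.
  by rewrite /inner big1// => w _; rewrite mulr0.
apply: le_integral_in_S => //; first exact: adm.
- by move=> w; exact: horizon_ge0.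
- by move=> q; exact: stage_payoff_ge0.
move=> q sq; rewrite inner_horizonS EFinD [(delta * _)%:E]EFinM; apply: leeD.
  rewrite lee_fin ler_wpM2l ?subr_ge0// indicE.
  have [/set_mem/c1//|_] := boolP (q \in _).
  by apply: inner_ge0 => //; exact: sq.1.
apply: lee_wpmul2l; first by rewrite lee_fin.
by rewrite -(cur_belief_rcons p M h q); apply: IH; exact: simplex_hist_rcons.
Qed.

Lemma simplex_cur_belief m (lam : R) (h : seq (vec R Omega)) :
  0 <= lam <= 1 -> simplex m -> simplex_hist h ->
  simplex (cur_belief m (trans m lam) h).
Proof.
move=> l01 sm; elim/last_ind: h => // h q _ sh.
rewrite cur_belief_rcons; apply: simplex_phi => //.
by have := sh (size h); rewrite size_rcons nth_rcons ltnn eqxx; apply.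
Qed.

(** * Admissibility of the greedy strategy and its matching lower bound *)

Section greedy.
Variables (m r c : vec R Omega) (lam delta : R).
Variables (g : vec R Omega -> R * vec R Omega * vec R Omega) (s : strategy R Omega).
Hypotheses (sm : simplex m) (lam01 : 0 <= lam <= 1) (delta01 : 0 <= delta <= 1).
Hypothesis gP : forall p, simplex p -> ~ Iset r p ->
  greedy_split r p (g p).1.1 (g p).1.2 (g p).2.
Hypothesis sP : is_greedy_strategy r m (trans m lam) g s.

Local Notation M := (trans m lam).

(** The Dirac mass is read as a degenerate splitting, so that the two-point lemmas cover both
    cases. *)
Lemma greedy_two_point_Iset (h : seq (vec R Omega)) (p := cur_belief m M h) :
  simplex_hist h -> Iset r p -> two_point (s h) 1 p p.
Proof.
by move=> sh Ip A mA; rewrite (sP sh mA).1// subrr mul0e adde0 mul1e.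
Qed.

Lemma greedy_two_point_Jset (h : seq (vec R Omega)) (p := cur_belief m M h) :
  simplex_hist h -> ~ Iset r p -> two_point (s h) (g p).1.1 (g p).1.2 (g p).2.
Proof. by move=> sh Jp A mA; rewrite (sP sh mA).2. Qed.

Lemma greedy_admissible : admissible m M s.
Proof.
move=> h sh; set p := cur_belief m M h.
have sp : simplex p by exact: simplex_cur_belief.
have [Ip|Jp] := pselect (Iset r p).
  apply: (in_S_two_point _ (greedy_two_point_Iset sh Ip)) => //.
    by rewrite ler01 lexx.
  by move=> w; rewrite subrr mul0r addr0 mul1r.
have [[a01 [[sI _] [sJ pE]]] _] := gP sp Jp.
exact: (in_S_two_point a01 (greedy_two_point_Jset sh Jp)).
Qed.

Hypotheses (dc : dominates r c) (mc : tight_at r c m).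

Lemma tight_at_phi q : tight_at r c q -> tight_at r c (phi M q).
Proof. by move=> qc; rewrite phi_trans; [exact: tight_at_conv lam01 mc qc|exact: qc.1]. Qed.

(** The inductive step at one tight posterior, stated apart because it serves for [p], [qI] and
    [qJ]. *)
Lemma stage_payoff_ge (N : nat) (h : seq (vec R Omega)) q :
  (forall h', simplex_hist h' -> tight_at r c (cur_belief m M h') ->
    ((inner (cur_belief m M h') (horizon M c delta N))%:E
     <= partial_payoff r delta s N h')%E) ->
  simplex_hist h -> tight_at r c q ->
  (((1 - delta) * \1_(Iset r) q + delta * inner (phi M q) (horizon M c delta N))%:E
   <= ((1 - delta) * \1_(Iset r) q)%:E
        + delta%:E * partial_payoff r delta s N (rcons h q))%E.
Proof.
move=> IH sh qc; have /andP[d0 _] := delta01.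
rewrite EFinD [(delta * _)%:E]EFinM leeD2l//; apply: lee_wpmul2l; first by rewrite lee_fin.
rewrite -(cur_belief_rcons m M h q); apply: IH.
  by apply: simplex_hist_rcons => //; exact: qc.1.
by rewrite cur_belief_rcons; exact: tight_at_phi.
Qed.

Lemma greedy_partial_payoff_ge (N : nat) (h : seq (vec R Omega)) :
  simplex_hist h -> tight_at r c (cur_belief m M h) ->
  ((inner (cur_belief m M h) (horizon M c delta N))%:E
   <= partial_payoff r delta s N h)%E.
Proof.
have /andP[d0 d1] := delta01; have [c0 c1] := dc.
elim: N h => [|N IH] h sh hc.
  by rewrite /inner big1// => w _; rewrite mulr0.
have [sp [x [xp xr xc]]] := hc.
rewrite inner_horizonS /=.
set p := cur_belief m M h in hc sp xp xc *.
have [Ip|Jp] := pselect (Iset r p).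
  apply: le_trans (ge_integral_two_point _ (greedy_two_point_Iset sh Ip) _); last 2 first.
  - by rewrite ler01 lexx.
  - by move=> q; exact: stage_payoff_ge0.
  rewrite subrr mul0e adde0 mul1e; apply: le_trans (stage_payoff_ge IH sh hc).
  rewrite indicE mem_set// lee_fin lerD2r ler_wpM2l ?subr_ge0//.
  (* The stage payoff is 1 here, and [inner p c] is at most the mass of [x], hence at most 1. *)
  by apply: le_trans xc _; rewrite -sp.2; apply: ler_sum => w _; have /andP[] := xp w.
have [[a01 [IqI [sJ pE]]] amax] := gP sp Jp.
have twop := greedy_two_point_Jset sh Jp.
rewrite -/p in twop; move: twop a01 IqI sJ pE amax.
case: (g p) => [[a qI] qJ] /= twop a01 IqI sJ pE amax.
(* The tightness witness [x] is itself the [I]-part of a feasible splitting, so maximality of [a]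
   gives [inner p c <= a]. *)
have [qI' [qJ' /amax xa]] := feasible_split_of_le sp IqI xp xr.
have pca : inner p c <= a := le_trans xc xa.
have /andP[a0 a1] := a01.
have pE' : p = (fun w => a * qI w + (1 - a) * qJ w) by apply/funext.
have qI1 := c1 _ IqI.
have qJ0 : 0 <= inner qJ c by apply: inner_ge0 => //; exact: sJ.1.
(* [a <qI, c> + (1 - a) <qJ, c> <= a] with [<qI, c> >= 1] and [<qJ, c> >= 0]:
   both are equalities, unless the corresponding weight vanishes. *)
have pcE : a * inner qI c + (1 - a) * inner qJ c <= a by rewrite -inner_lin -pE'.
have aI : a != 0 -> tight_at r c qI.
  move=> an0; apply: tight_at_Iset => //.
  have ap : 0 < a by rewrite lt_def an0.
  rewrite -(ler_pM2l ap) mulr1; apply: le_trans pcE.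
  by rewrite lerDl mulr_ge0// subr_ge0.
have aJ : 1 - a != 0 -> tight_at r c qJ.
  move=> an0; apply: tight_at_zero => //.
  have ap : 0 < 1 - a by rewrite lt_def an0 subr_ge0.
  rewrite -(ler_pM2l ap) mulr0; have : a <= a * inner qI c by rewrite ler_peMr.
  by lra.
apply: le_trans (ge_integral_two_point a01 twop _); last first.
  by move=> q; exact: stage_payoff_ge0.
pose v q := inner (phi M q) (horizon M c delta N).
have vp : v p = a * v qI + (1 - a) * v qJ by rewrite /v !inner_phi pE' inner_lin.
(* Intermediate value: stage payoff 1 at [qI] and 0 at [qJ], with the continuation split by
   linearity of [v]. *)
apply: (@le_trans _ _ ((a * ((1 - delta) + delta * v qI)
                       + (1 - a) * (delta * v qJ))%:E)).
  rewrite lee_fin -/(v p) vp.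
  have : (1 - delta) * inner p c <= (1 - delta) * a by rewrite ler_wpM2l// subr_ge0.
  by lra.
rewrite EFinD [X in (X + _)%E]EFinM [X in (_ + X)%E]EFinM; apply: leeD.
  (* A posterior of zero weight may fail to be tight, but its term vanishes. *)
  have [->|/aI tI] := eqVneq a 0; first by rewrite !mul0e.
  apply: lee_wpmul2l; first by rewrite lee_fin.
  by apply: le_trans (stage_payoff_ge IH sh tI); rewrite indicE mem_set// mulr1.
have [->|/aJ tJ] := eqVneq (1 - a) 0; first by rewrite !mul0e.
apply: lee_wpmul2l; first by rewrite lee_fin subr_ge0.
apply: le_trans (stage_payoff_ge IH sh tJ).
by rewrite lee_fin lerDr mulr_ge0// subr_ge0.
Qed.

End greedy.
End belief.

Theorem theorem2 (R : realType) (Omega : finType) (m : vec R Omega) (lam : R)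
    (r : vec R Omega) (delta : R)
    (g : vec R Omega -> R * vec R Omega * vec R Omega) (s : strategy R Omega) :
  simplex m ->
  0 <= lam < 1 ->
  irreducible (trans m lam) ->
  0 <= delta < 1 ->
  (forall p, simplex p -> ~ Iset r p ->
     greedy_split r p (g p).1.1 (g p).1.2 (g p).2) ->
  is_greedy_strategy r m (trans m lam) g s ->
  admissible m (trans m lam) s /\
  payoff r delta s = value r delta m (trans m lam).
Proof.
move=> sm /andP[l0 /ltW l1] _ /andP[d0 /ltW d1] gP sP.
have l01 : 0 <= lam <= 1 by rewrite l0.
have d01 : 0 <= delta <= 1 by rewrite d0.
have adm : admissible m (trans m lam) s by exact: greedy_admissible gP sP.
split => //; have [c [dc mc]] := dominates_tight_at r sm.
have sh : simplex_hist ([::] : seq (vec R Omega)) by [].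
apply/eqP; rewrite eq_le; apply/andP; split.
  by apply: ereal_sup_ubound; exists s.
apply: ge_ereal_sup => _ [s' adm' <-].
apply: ge_ereal_sup => _ [N _ <-].
(* The comparison is made at each fixed [N], with the same linear bound above the competitor and
   below the greedy payoff, so no limit has to be computed. *)
apply: (@le_trans _ _ (partial_payoff r delta s N [::])); last first.
  by apply: ereal_sup_ubound; exists N.
apply: le_trans (partial_payoff_le N _ dc d01 adm' sh) _.
  by move=> w w'; exact: trans_ge0.
exact: (greedy_partial_payoff_ge l01 d01 gP sP dc mc N sh mc).
Qed.
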